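(* Let $f:[0,\infty)\to\mathbb{R}$ be a continuous function such that $$f\left(\left(\frac{A^{1/2}+B^{1/2}}{2}\right)^{2}\right)\le f\left(\frac{A+B}{2}\right)$$ for all positive integers $n$ and all positive semidefinite $n\times n$ complex matrices $A$ and $B$. Then $f$ is operator monotone on $[0,\infty)$.
   Context: For Hermitian matrices, $X\le Y$ means that $Y-X$ is positive semidefinite (Loewner order), and $f(X)$ is defined by the functional calculus. A continuous real function $f$ is operator monotone on an interval $I\subset\mathbb{R}$ if, for every $n$ and all Hermitian $n\times n$ complex matrices $A,B$ with spectra in $I$, $A\le B$ implies $f(A)\le f(B)$. *)

(* Defs.v *)
From mathcomp Require Import all_boot all_order all_algebra.
From mathcomp Require Import all_classical all_reals all_analysis.
From mathcomp Require Import complex.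

Set Implicit Arguments.
Unset Strict Implicit.
Unset Printing Implicit Defensive.

Import Order.TTheory GRing.Theory Num.Theory.
Import numFieldNormedType.Exports.

Local Open Scope classical_set_scope.
Local Open Scope ring_scope.
Local Open Scope complex_scope.
Local Open Scope sesquilinear_scope.

(* In the order of R[i], [0 <= z] means that z is real and nonnegative. *)
Definition psdmx (R : realType) (n : nat) (A : 'M[R[i]]_n) : Prop :=
  A \is hermsymmx /\ forall x : 'cV[R[i]]_n, 0 <= (x ^t* *m A *m x) 0 0.

Definition loewner_le (R : realType) (n : nat) (X Y : 'M[R[i]]_n) : Prop :=
  psdmx (Y - X).

(* For Hermitian A = P^* diag(d) P with P unitary, f(A) = P^* diag(f(d)) P. The
   eigenvalues d are real, so that applying f to their real parts loses
   nothing; the value does not depend on the choice of P and d, see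
   [fun_calc_unitary]. *)
Definition fun_calc (R : realType) (f : R -> R) (n : nat) (A : 'M[R[i]]_n) :
    'M[R[i]]_n :=
  (spectralmx A) ^t*
    *m diag_mx (\row_j (f (complex.Re (spectral_diag A 0 j)))%:C)
    *m spectralmx A.

Lemma fun_calc_unitary (R : realType) (f : R -> R) (n : nat)
    (U : 'M[R[i]]_n) (d : 'I_n -> R) :
  U \is unitarymx ->
  fun_calc f (U ^t* *m diag_mx (\row_j (d j)%:C) *m U)
  = U ^t* *m diag_mx (\row_j (f (d j))%:C) *m U.
Proof.
move=> Uu; set A := (X in fun_calc f X).
have An : A \is normalmx.
  apply/orthomx_spectral_subproof.
  exists (U, \row_j (d j)%:C) => //=.
  by rewrite invmx_unitary.
have Pu := spectral_unitarymx A.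
move/orthomx_spectralP: An; rewrite invmx_unitary// => EA.
rewrite /fun_calc; set P := spectralmx A in Pu EA *.
set s := spectral_diag A in EA *.
pose W := P *m U ^t*.
have PPt : P *m P ^t* = 1%:M by apply/unitarymxP.
have UUt : U *m U ^t* = 1%:M by apply/unitarymxP.
have PtP : P ^t* *m P = 1%:M by apply: mulmx1C.
have UtU : U ^t* *m U = 1%:M by apply: mulmx1C.
have EW : diag_mx s *m W = W *m diag_mx (\row_j (d j)%:C).
  have : P *m A *m U ^t* = P *m A *m U ^t* by [].
  rewrite {1}EA {1}/A /W !mulmxA PPt mul1mx => ->.
  by rewrite -[in LHS](mulmxA _ U) UUt mulmx1.
have EfW : diag_mx (\row_j (f (complex.Re (s 0 j)))%:C) *m W
           = W *m diag_mx (\row_j (f (d j))%:C).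
  apply/matrixP => i j; rewrite mul_diag_mx mul_mx_diag !mxE.
  have /matrixP/(_ i j) := EW; rewrite mul_diag_mx mul_mx_diag !mxE.
  rewrite [RHS]mulrC => eqw; rewrite [RHS]mulrC.
  have [->|w0] := eqVneq (\sum_k P i k * U ^t* k j) 0; first by rewrite !mulr0.
  by move/(mulIf w0): eqw => ->.
transitivity (P ^t* *m (diag_mx (\row_j (f (complex.Re (s 0 j)))%:C) *m W) *m U).
  by rewrite /W !mulmxA -(mulmxA _ (U ^t*)) UtU mulmx1.
by rewrite EfW /W !mulmxA PtP mul1mx.
Qed.

Definition sqrtmx (R : realType) (n : nat) (A : 'M[R[i]]_n) : 'M[R[i]]_n :=
  fun_calc (@Num.sqrt R) A.

Definition spectrum_in (R : realType) (I : interval R) (n : nat)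
    (A : 'M[R[i]]_n) : Prop :=
  forall z : R[i], eigenvalue A z -> exists2 x : R, x \in I & z = x%:C.

Definition operator_monotone (R : realType) (I : interval R) (f : R -> R) :
    Prop :=
  {within [set` I], continuous f} /\
  forall (n : nat) (A B : 'M[R[i]]_n),
    A \is hermsymmx -> B \is hermsymmx ->
    spectrum_in I A -> spectrum_in I B ->
    loewner_le A B -> loewner_le (fun_calc f A) (fun_calc f B).

(* Main.v *)
(* Write S and T for half the sum and half the difference of A^(1/2) and
   B^(1/2).  The hypothesis reads f(S^2) <= f(S^2 + T^2), for all Hermitian S
   and T with -S <= T <= S.  If P >= eps > 0, then S = P^(1/2) >= eps^(1/2), so
   that T = E^(1/2) is admissible whenever 0 <= E <= eps: hence
   f(P) <= f(P + E).  A larger increment is cut into N equal parts, each at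
   most eps, which gives f(A + eps) <= f(B + eps) whenever 0 <= A <= B; let eps
   tend to 0 in the quadratic forms, where only the eigenvalues move. *)
Require Import Defs.
From mathcomp Require Import all_boot all_order all_algebra.
From mathcomp Require Import all_classical all_reals all_analysis.
From mathcomp Require Import complex.
From mathcomp Require Import ring.
Import Order.TTheory GRing.Theory Num.Theory.
Import numFieldNormedType.Exports.
Local Open Scope classical_set_scope.
Local Open Scope ring_scope.
Local Open Scope complex_scope.
Local Open Scope sesquilinear_scope.

Set Implicit Arguments.
Unset Strict Implicit.
Unset Printing Implicit Defensive.

(** * Diagonal forms, Hermitian matrices and the Loewner preorder *)

(** A diagonalisation with explicit real eigenvalues [d] in a freely chosen unitary basis, whereas
    [fun_calc] is tied to the one picked by [spectralmx]. *)
Definition unitary_diag (R : realType) (n : nat) (U : 'M[R[i]]_n)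
    (d : 'I_n -> R) : 'M[R[i]]_n :=
  U ^t* *m diag_mx (\row_j (d j)%:C) *m U.

(** The hypothesis of the theorem on [f], packaged so that lemmas can take it as an argument. *)
Definition sqrt_mean_le (R : realType) (f : R -> R) : Prop :=
  forall (n : nat) (A B : 'M[R[i]]_n), (0 < n)%N -> psdmx A -> psdmx B ->
    loewner_le
      (fun_calc f ((2^-1 *: (sqrtmx A + sqrtmx B)) ^+ 2))
      (fun_calc f (2^-1 *: (A + B))).

Lemma hermsymmxP (R : realType) (n : nat) (A : 'M[R[i]]_n) :
  reflect (A ^t* = A) (A \is hermsymmx).
Proof.
by rewrite is_hermitianmxE expr0 scale1r eq_sym; apply: eqP.
Qed.

Lemma adjmxM (R : realType) (m n p : nat) (A : 'M[R[i]]_(m, n))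
    (B : 'M[R[i]]_(n, p)) : (A *m B) ^t* = B ^t* *m A ^t*.
Proof. by rewrite trmx_mul map_mxM. Qed.

Lemma hermsymmxD (R : realType) (n : nat) (A B : 'M[R[i]]_n) :
  A \is hermsymmx -> B \is hermsymmx -> A + B \is hermsymmx.
Proof.
move=> /hermsymmxP hA /hermsymmxP hB; apply/hermsymmxP.
by rewrite linearD /= map_mxD hA hB.
Qed.

Lemma psdmxD (R : realType) (n : nat) (A B : 'M[R[i]]_n) :
  psdmx A -> psdmx B -> psdmx (A + B).
Proof.
move=> [hA pA] [hB pB]; split; first exact: hermsymmxD.
by move=> x; rewrite mulmxDr mulmxDl mxE addr_ge0.
Qed.

Lemma loewner_le_refl (R : realType) (n : nat) (A : 'M[R[i]]_n) :
  loewner_le A A.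
Proof.
rewrite /loewner_le subrr; split=> [|x].
  by apply/hermsymmxP; rewrite linear0 map_mx0.
by rewrite mulmx0 mul0mx mxE.
Qed.

Lemma loewner_le_trans (R : realType) (n : nat) (B A C : 'M[R[i]]_n) :
  loewner_le A B -> loewner_le B C -> loewner_le A C.
Proof. by move=> AB BC; have := psdmxD AB BC; rewrite addrC addrA subrK. Qed.

(** * Arithmetic of matrices diagonal in a common unitary basis *)

Lemma eq_unitary_diag (R : realType) (n : nat) (U : 'M[R[i]]_n) d e :
  d =1 e -> unitary_diag U d = unitary_diag U e.
Proof. by move=> /funext ->. Qed.

Lemma conj_diagD (K : pzRingType) (n : nat) (V U : 'M[K]_n) (d e : 'rV_n) :
  V *m diag_mx d *m U + V *m diag_mx e *m U = V *m diag_mx (d + e) *m U.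
Proof. by rewrite linearD /= mulmxDr mulmxDl. Qed.

Lemma conj_diagN (K : pzRingType) (n : nat) (V U : 'M[K]_n) (d : 'rV_n) :
  - (V *m diag_mx d *m U) = V *m diag_mx (- d) *m U.
Proof. by rewrite linearN /= mulmxN mulNmx. Qed.

Lemma conj_diagM (K : pzRingType) (n : nat) (V U : 'M[K]_n) (d e : 'rV_n) :
  U *m V = 1%:M ->
  (V *m diag_mx d *m U) *m (V *m diag_mx e *m U)
  = V *m diag_mx (\row_j (d 0 j * e 0 j)) *m U.
Proof.
by move=> UV; rewrite !mulmxA -(mulmxA _ U) UV mulmx1 -(mulmxA V) mulmx_diag.
Qed.

Lemma unitary_diagD (R : realType) (n : nat) (U : 'M[R[i]]_n) d e :
  unitary_diag U d + unitary_diag U e = unitary_diag U (fun j => d j + e j).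
Proof.
etransitivity; first exact: conj_diagD.
apply: (congr1 (fun r => U ^t* *m diag_mx r *m U)).
by apply/rowP => j; rewrite !mxE rmorphD.
Qed.

Lemma unitary_diagN (R : realType) (n : nat) (U : 'M[R[i]]_n) d :
  - unitary_diag U d = unitary_diag U (fun j => - d j).
Proof.
etransitivity; first exact: conj_diagN.
apply: (congr1 (fun r => U ^t* *m diag_mx r *m U)).
by apply/rowP => j; rewrite !mxE rmorphN.
Qed.

Lemma unitary_diagM (R : realType) (n : nat) (U : 'M[R[i]]_n) d e :
  U \is unitarymx ->
  unitary_diag U d *m unitary_diag U e = unitary_diag U (fun j => d j * e j).
Proof.
move=> /unitarymxP UU; etransitivity; first exact: conj_diagM.
apply: (congr1 (fun r => U ^t* *m diag_mx r *m U)).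
by apply/rowP => j; rewrite !mxE rmorphM.
Qed.

Lemma fun_calc_unitary_diag (R : realType) (f : R -> R) (n : nat)
    (U : 'M[R[i]]_n) d :
  U \is unitarymx -> fun_calc f (unitary_diag U d) = unitary_diag U (f \o d).
Proof. exact: fun_calc_unitary. Qed.

(** Scalar matrices are diagonal in every unitary basis at once; this is what later links matrices
    diagonal in two different bases. *)
Lemma unitary_diag_const (R : realType) (n : nat) (U : 'M[R[i]]_n) (c : R) :
  U \is unitarymx -> unitary_diag U (fun=> c) = (c%:C)%:M.
Proof.
move=> /unitarymxP UU; have {}UU := mulmx1C UU.
rewrite /unitary_diag (_ : diag_mx _ = (c%:C)%:M).
  by rewrite mul_mx_scalar -scalemxAl UU scalemx1.
by apply/matrixP => i j; rewrite !mxE.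
Qed.

Lemma unitary_diag_hermsymmx (R : realType) (n : nat) (U : 'M[R[i]]_n) d :
  unitary_diag U d \is hermsymmx.
Proof.
apply/hermsymmxP; rewrite /unitary_diag !adjmxM trmxCK mulmxA.
congr (_ *m _ *m _); rewrite tr_diag_mx map_diag_mx; congr diag_mx.
by apply/rowP => j; rewrite !mxE; exact: conjc_real.
Qed.

(** * Quadratic forms as real sums *)

(** The squared modulus, taken in [R] rather than [R[i]] so that quadratic forms become real
    sums. *)
Definition normsq (R : realType) (z : R[i]) : R :=
  complex.Re z ^+ 2 + complex.Im z ^+ 2.

Lemma quad_unitary_diag (R : realType) (n : nat) (U : 'M[R[i]]_n) d
    (x : 'cV[R[i]]_n) :
  (x ^t* *m unitary_diag U d *m x) 0 0 =
  (\sum_j d j * normsq ((U *m x) j 0%R))%:C.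
Proof.
rewrite /unitary_diag !mulmxA -adjmxM -mulmxA.
move: (U *m x) => y; rewrite mxE rmorph_sum.
apply: eq_bigr => j _; rewrite mul_mx_diag !mxE rmorphM /= /normsq add_Re2_Im2.
by rewrite sqr_normc mulrAC mulrC (mulrC (y j 0)).
Qed.

(** Turns the order into real inequalities in which the eigenvalues occur linearly and the weights
    depend only on the bases and on [x]. This is the form in which the limit is taken. *)
Lemma loewner_le_unitary_diagP (R : realType) (n : nat) (U V : 'M[R[i]]_n) a b :
  loewner_le (unitary_diag U a) (unitary_diag V b) <->
  forall x : 'cV_n, \sum_j a j * normsq ((U *m x) j 0%R)
                    <= \sum_j b j * normsq ((V *m x) j 0%R).
Proof.
have quad (x : 'cV_n) :
    (x ^t* *m (unitary_diag V b - unitary_diag U a) *m x) 0 0 =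
    (\sum_j b j * normsq ((V *m x) j 0%R)
     - \sum_j a j * normsq ((U *m x) j 0%R))%:C.
  rewrite unitary_diagN mulmxDr mulmxDl mxE !quad_unitary_diag -rmorphD.
  congr (_%:C); rewrite -sumrN; congr (_ + _).
  by apply: eq_bigr => j _; rewrite mulNr.
split=> [[_ ab] x|ab]; first by rewrite -subr_ge0 -ler0c -quad.
split=> [|x]; last by rewrite quad ler0c subr_ge0.
rewrite unitary_diagN.
exact: hermsymmxD (unitary_diag_hermsymmx _ _) (unitary_diag_hermsymmx _ _).
Qed.

Lemma unitary_diag_psdmx (R : realType) (n : nat) (U : 'M[R[i]]_n) d :
  (forall j, 0 <= d j) -> psdmx (unitary_diag U d).
Proof.
move=> d0; split; first exact: unitary_diag_hermsymmx.
move=> x; rewrite quad_unitary_diag ler0c sumr_ge0// => j _.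
by rewrite mulr_ge0// addr_ge0// sqr_ge0.
Qed.

(** * Spectral theorem and positivity of eigenvalues *)

Lemma hermsymmx_unitary_diag (R : realType) (n : nat) (A : 'M[R[i]]_n) :
  A \is hermsymmx ->
  exists U d, U \is unitarymx /\ A = unitary_diag U d.
Proof.
move=> hA; exists (spectralmx A), (fun j => complex.Re (spectral_diag A 0 j)).
have Uu := spectral_unitarymx A; split=> //.
have /orthomx_spectralP := hermitian_normalmx hA; rewrite invmx_unitary// => EA.
rewrite [LHS]EA.
apply: (congr1 (fun r => (spectralmx A) ^t* *m diag_mx r *m spectralmx A)).
apply/rowP => j; rewrite mxE RRe_real//.
by have /mxOverP := hermitian_spectral_diag_real hA.
Qed.

Lemma unitary_diagE (R : realType) (n : nat) (U : 'M[R[i]]_n) d j :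
  U \is unitarymx ->
  (U *m unitary_diag U d *m U ^t*) j j = (d j)%:C.
Proof.
move=> /unitarymxP UU; rewrite /unitary_diag !mulmxA UU mul1mx -mulmxA UU mulmx1.
by rewrite !mxE eqxx.
Qed.

(** The eigenvalue [d j] is the value of the quadratic form at the adjoint of row [j] of [U], hence
    nonnegative. *)
Lemma psdmx_unitary_diag (R : realType) (n : nat) (A : 'M[R[i]]_n) :
  psdmx A ->
  exists U d, [/\ U \is unitarymx, A = unitary_diag U d & forall j, 0 <= d j].
Proof.
move=> [/hermsymmx_unitary_diag[U [d [Uu EA]]] pA]; exists U, d; split=> // j.
have := pA ((row j U) ^t*); rewrite trmxCK -ler0c -(unitary_diagE d j Uu) -EA.
suff -> : (row j U *m A *m (row j U) ^t*) 0 0 = (U *m A *m U ^t*) j j by [].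
rewrite -row_mul !mxE; apply: eq_bigr => k _.
by rewrite !mxE.
Qed.

(** Row [j] of [U] is a left eigenvector for [d j]; it is nonzero because the diagonal entries of
    [U *m U ^t*] are 1. *)
Lemma hermsymmx_spectrum_ge0 (R : realType) (n : nat) (A : 'M[R[i]]_n) :
  A \is hermsymmx -> spectrum_in `[0, +oo[ A -> psdmx A.
Proof.
move=> /hermsymmx_unitary_diag[U [d [Uu ->]]] sA.
apply: unitary_diag_psdmx => j.
have /unitarymxP UU := Uu.
have /sA [x] : eigenvalue (unitary_diag U d) (d j)%:C.
  apply/eigenvalueP; exists (row j U).
    rewrite -row_mul /unitary_diag !mulmxA UU mul1mx mul_diag_mx.
    by apply/rowP => k; rewrite !mxE.
  apply: contraTneq (oner_neq0 R[i]) => Uj0.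
  have /matrixP/(_ j j) := UU; rewrite !mxE eqxx mulr1n => <-.
  rewrite big1 ?eqxx// => k _.
  by have /rowP/(_ k) := Uj0; rewrite !mxE => ->; rewrite mul0r.
by rewrite in_itv/= andbT => x0 /complexI ->.
Qed.

(** * The hypothesis in terms of half-sum and half-difference *)

Lemma psdmx_sqr (R : realType) (n : nat) (A : 'M[R[i]]_n) :
  psdmx A -> psdmx (A *m A).
Proof.
move=> /psdmx_unitary_diag[U [d [Uu -> _]]]; rewrite unitary_diagM//.
by apply: unitary_diag_psdmx => j; rewrite -expr2 sqr_ge0.
Qed.

Lemma sqrtmx_sqr (R : realType) (n : nat) (A : 'M[R[i]]_n) :
  psdmx A -> sqrtmx (A *m A) = A.
Proof.
move=> /psdmx_unitary_diag[U [d [Uu -> d0]]]; rewrite unitary_diagM//.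
have {3}<- : (@Num.sqrt R) \o (fun j => d j * d j) = d.
  by apply/funext => j /=; rewrite -expr2 sqrtr_sqr ger0_norm.
exact: (fun_calc_unitary_diag _ _ Uu).
Qed.

Lemma half_mxD (F : numFieldType) (n : nat) (X : 'M[F]_n) :
  2^-1 *: (X + X) = X.
Proof. by rewrite scalerDr -scalerDl -[2^-1]mul1r -splitr scale1r. Qed.

(** Parallelogram identity: the cross terms cancel even when [S] and [T] do not commute. *)
Lemma mean_mxsqr (F : numFieldType) (n : nat) (S T : 'M[F]_n) :
  2^-1 *: ((S + T) *m (S + T) + (S - T) *m (S - T)) = S *m S + T *m T.
Proof.
rewrite -[RHS]half_mxD; congr (_ *: _).
rewrite !(mulmxDl, mulmxDr, mulNmx, mulmxN, opprK).
(* With the four products made opaque, each entry is an identity in a commutative ring. *)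
move: (S *m S) (S *m T) (T *m S) (T *m T) => a b c e.
by apply/matrixP => i j; rewrite !mxE; ring.
Qed.

(** Apply the hypothesis to the squares of [S + T] and [S - T]: positivity makes these two matrices
    the square roots. *)
Lemma sqrt_mean_le_sqrD (R : realType) (f : R -> R) (n : nat)
    (S T : 'M[R[i]]_n) :
  sqrt_mean_le f -> (0 < n)%N -> psdmx (S + T) -> psdmx (S - T) ->
  loewner_le (fun_calc f (S *m S)) (fun_calc f (S *m S + T *m T)).
Proof.
move=> f_mid n0 pST pSNT.
have := f_mid _ _ _ n0 (psdmx_sqr pST) (psdmx_sqr pSNT).
rewrite (sqrtmx_sqr pST) (sqrtmx_sqr pSNT) (mean_mxsqr S T).
have -> : 2^-1 *: (S + T + (S - T)) = S.
  by rewrite addrACA subrr addr0; exact: half_mxD.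
exact.
Qed.

(** * From small increments to arbitrary ones *)

(** Take for [S] the root of [P + eps] and for [T] the root of the increment. The scalar
    [Num.sqrt eps] lies between [T] and [S], so both [S + T] and [S - T] are positive
    semidefinite. *)
Lemma sqrt_mean_le_step (R : realType) (f : R -> R) (n : nat)
    (P V : 'M[R[i]]_n) (e : 'I_n -> R) (eps : R) :
  sqrt_mean_le f -> (0 < n)%N -> psdmx P -> V \is unitarymx ->
  (forall j, 0 <= e j <= eps) ->
  loewner_le (fun_calc f (P + (eps%:C)%:M))
             (fun_calc f (P + (eps%:C)%:M + unitary_diag V e)).
Proof.
move=> f_mid n0 /psdmx_unitary_diag[U [d [Uu -> d0]]] Vu eP.
have eps0 : 0 <= eps.
  by have /andP[e0 /(le_trans e0)] := eP (Ordinal n0).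
rewrite -(unitary_diag_const eps Uu) unitary_diagD.
pose s j := Num.sqrt (d j + eps); pose t j := Num.sqrt (e j).
have sP j : Num.sqrt eps <= s j by rewrite ler_wsqrtr// lerDr.
have tP j : t j <= Num.sqrt eps by rewrite ler_wsqrtr//; case/andP: (eP j).
have -> : unitary_diag U (fun j => d j + eps)
          = unitary_diag U s *m unitary_diag U s.
  rewrite (unitary_diagM s s Uu).
  apply: eq_unitary_diag => j.
  by rewrite -expr2 sqr_sqrtr// addr_ge0.
have -> : unitary_diag V e = unitary_diag V t *m unitary_diag V t.
  rewrite (unitary_diagM t t Vu).
  apply: eq_unitary_diag => j.
  by rewrite -expr2 sqr_sqrtr//; case/andP: (eP j).
apply: sqrt_mean_le_sqrD => //.
  by apply: psdmxD; apply: unitary_diag_psdmx => j; exact: sqrtr_ge0.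
(* Split [S - T] as (S - sqrt eps) + (sqrt eps - T), writing the scalar in the basis [U] in the
   first term and in the basis [V] in the second. *)
rewrite -(subrK ((Num.sqrt eps)%:C)%:M (unitary_diag U s)) -addrA.
rewrite -{1}(unitary_diag_const _ Uu) -(unitary_diag_const _ Vu).
rewrite !unitary_diagN !unitary_diagD.
by apply: psdmxD; apply: unitary_diag_psdmx => j; rewrite subr_ge0.
Qed.

Lemma sqrt_mean_le_shift (R : realType) (f : R -> R) (n : nat)
    (A B : 'M[R[i]]_n) (eps : R) :
  sqrt_mean_le f -> (0 < n)%N -> psdmx A -> loewner_le A B -> 0 < eps ->
  loewner_le (fun_calc f (A + (eps%:C)%:M)) (fun_calc f (B + (eps%:C)%:M)).
Proof.
move=> f_mid n0 pA /psdmx_unitary_diag[V [e [Vu EBA e0]]] eps0.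
have -> : B = A + unitary_diag V e by rewrite -EBA addrC subrK.
(* The sum bounds every [e j], so [N] above its quotient by [eps] gives [e j / N <= eps] for all
   [j]; the successor also keeps [N] nonzero. *)
pose N := (Num.truncn ((\sum_j e j) / eps)).+1.
have eN j : 0 <= e j / N%:R <= eps.
  rewrite divr_ge0//= ler_pdivrMr// -ler_pdivrMl// mulrC.
  apply/ltW/(le_lt_trans _ (truncnS_gt _)).
  by rewrite ler_pM2r ?invr_gt0// (bigD1 j)//= lerDl sumr_ge0//.
(* [g k] is the part k/N of the increment [B - A]. *)
pose g k := unitary_diag V (fun j => k%:R * (e j / N%:R)).
have g0 : g 0%N = 0.
  rewrite /g (@eq_unitary_diag _ _ _ _ (fun=> 0)) => [|j]; last by rewrite mul0r.
  rewrite unitary_diag_const//.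
  by apply/matrixP => i j; rewrite !mxE mul0rn.
pose D := unitary_diag V (fun j => e j / N%:R).
have gS k : g k + D = g k.+1.
  rewrite unitary_diagD; apply: eq_unitary_diag => j.
  by rewrite -[in RHS]addn1 natrD mulrDl mul1r.
have <- : g N = unitary_diag V e.
  by apply: eq_unitary_diag => j; rewrite mulrC divfK// pnatr_eq0.
(* Only the number of steps is generalised for the induction; the step size inside [g] keeps the
   fixed [N]. *)
move: (X in g X) => k.
elim: k => [|k IH]; first by rewrite g0 addr0; exact: loewner_le_refl.
apply: (loewner_le_trans IH).
have pAg : psdmx (A + g k).
  apply: (psdmxD pA); apply: unitary_diag_psdmx => j.
  by apply: mulr_ge0 => //; case/andP: (eN j).
have := sqrt_mean_le_step f_mid n0 pAg Vu eN.
rewrite -/D; set c := (eps%:C)%:M.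
have -> : A + g k + c + D = A + g k.+1 + c by rewrite -gS addrAC addrA.
exact.
Qed.

(** * Removing the shift by a limit *)

(** At [a = 0] this is the one-sided continuity at the endpoint; for [a > 0] two-sided continuity at
    an interior point restricts to the right. *)
Lemma cvg_shift_right (R : realType) (f : R -> R) (a : R) :
  {within [set` `[0, +oo[], continuous f} -> 0 <= a ->
  f (a + eps) @[eps --> 0^'+] --> f a.
Proof.
move=> /continuous_within_itvcyP[f_in f_0].
rewrite le_eqVlt => /predU1P[<-|a0].
  by under eq_fun do rewrite add0r.
apply: cvg_at_right_filter; apply: continuous_cvg.
  by apply: f_in; rewrite in_itv/= a0.
rewrite -[X in _ --> X]addr0; apply: cvgD; [exact: cvg_cst|exact: cvg_id].
Qed.

Theorem theorem6 (R : realType) (f : R -> R)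
  (f_cont : {within [set` `[0, +oo[], continuous f})
  (f_mid : forall (n : nat) (A B : 'M[R[i]]_n), (0 < n)%N ->
     psdmx A -> psdmx B ->
     loewner_le
       (fun_calc f ((2^-1 *: (sqrtmx A + sqrtmx B)) ^+ 2))
       (fun_calc f (2^-1 *: (A + B)))) :
  operator_monotone `[0, +oo[ f.
Proof.
split; first exact: f_cont.
move=> n A B hA hB sA sB AB.
have pA := hermsymmx_spectrum_ge0 hA sA.
have pB := hermsymmx_spectrum_ge0 hB sB.
(* The hypothesis speaks of positive sizes only; empty matrices are all equal. *)
case: n => [|n] in A B hA hB sA sB AB pA pB *.
  by rewrite [fun_calc f B]thinmx0 [fun_calc f A]thinmx0; exact: loewner_le_refl.
case: (psdmx_unitary_diag pA) => U [a [Uu EA a0]].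
case: (psdmx_unitary_diag pB) => V [b [Vu EB b0]].
(* Adding a scalar shifts the eigenvalues and leaves the eigenbasis fixed. *)
have fE (W : 'M[R[i]]_n.+1) d eps : W \is unitarymx ->
    fun_calc f (unitary_diag W d + (eps%:C)%:M)
    = unitary_diag W (fun j => f (d j + eps)).
  move=> Wu; rewrite -(unitary_diag_const eps Wu) unitary_diagD.
  exact: fun_calc_unitary_diag.
have fA := fun_calc_unitary_diag f a Uu.
have fB := fun_calc_unitary_diag f b Vu.
rewrite -EA in fA; rewrite -EB in fB; rewrite fA fB.
apply/loewner_le_unitary_diagP => x; rewrite -subr_ge0.
(* Since the basis does not move with [eps], the weights are constant, and a finite sum converges
   term by term. *)
have cvg_quad d (w : 'I_n.+1 -> R) : (forall j, 0 <= d j) ->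
    \sum_j f (d j + eps) * w j @[eps --> 0^'+] --> \sum_j f (d j) * w j.
  move=> d0; apply: cvg_big => [|j _]; first exact: add_continuous.
  by apply: cvgMr_tmp; exact: cvg_shift_right.
pose w (W : 'M[R[i]]_n.+1) j := normsq ((W *m x) j 0%R).
(* The difference of the two shifted forms is nonnegative for every [eps > 0], so its limit is
   too. *)
apply: (cvgr_to_ge (cvgB (cvg_quad b (w V) b0) (cvg_quad a (w U) a0))).
near=> eps.
have eps0 : 0 < eps by [].
have := sqrt_mean_le_shift f_mid (ltn0Sn n) pA AB eps0.
rewrite EA EB (fE U a eps Uu) (fE V b eps Vu).
by move/loewner_le_unitary_diagP => /(_ x); rewrite subr_ge0.
Unshelve. all: by end_near.
Qed.
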